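(* For all integers $n\ge0$ and $m$, there is a bijection between the set of Motzkin paths (respectively Grand Motzkin paths) from $(0,0)$ to $(2n+1,m)$ that avoid flat steps at odd indices, and the set of vertically constrained $S_{DW}$ paths from $(0,0)$ to $(n,m)$ all of whose vertices have $y\ge0$ (respectively, with no height restriction), the first step of the latter being arbitrary.
   Context: A lattice path is a finite sequence of steps (vectors in $\mathbb{Z}^2$) starting at $(0,0)$; its vertices are the partial sums. A Grand Motzkin path is a lattice path with steps in $\{(1,0),(1,1),(1,-1)\}$; a Motzkin path is a Grand Motzkin path all of whose vertices have $y\ge0$. The step $(1,0)$ is called flat. The steps of a path of $L$ steps are indexed $e_0,e_1,\dots,e_{L-1}$, and ''avoids flat steps at odd indices'' means $e_i\neq(1,0)$ for every odd $i$. Let $S_{DW}=\{(1,1),(1,-1),(0,1),(0,-1)\}$; $(0,\pm1)$ are vertical steps. A vertically constrained $S_{DW}$ path is a lattice path with steps in $S_{DW}$ with no two consecutive vertical steps. *)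

(* Defs.v *)
From HB Require Import structures.
From mathcomp Require Import all_boot all_order all_algebra.
Set Implicit Arguments.
Unset Strict Implicit.
Unset Printing Implicit Defensive.
Import Order.TTheory GRing.Theory Num.Theory.
Local Open Scope ring_scope.

Definition step : Type := (int * int)%type.
Definition lpath : Type := seq step.

(* The vertices include the starting point (0, 0), also for the empty path. *)
Definition vertices (p : lpath) : seq (int * int) :=
  0 :: scanl (fun v s : int * int => v + s) 0 p.

Definition endpoint (p : lpath) : int * int := last 0 (vertices p).

Definition nonneg_heights (p : lpath) : bool :=
  all (fun v : int * int => 0 <= v.2) (vertices p).

Definition flat : step := (1, 0).

Definition motzkin_steps : seq step := [:: (1, 0); (1, 1); (1, -1)].

Definition grand_motzkin (p : lpath) : bool :=
  all (fun s : step => s \in motzkin_steps) p.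

Definition motzkin (p : lpath) : bool := grand_motzkin p && nonneg_heights p.

Definition avoids_flat_at_odd (p : lpath) : bool :=
  [forall i : 'I_(size p), odd i ==> (nth 0 p i != flat)].

Definition SDW : seq step := [:: (1, 1); (1, -1); (0, 1); (0, -1)].

Definition vertical (s : step) : bool := s \in [:: (0, 1); (0, -1) : step].

(* [sorted e p] only relates consecutive entries of [p]; nothing is required
   of the first step. *)
Definition vc_SDW (p : lpath) : bool :=
  all (fun s : step => s \in SDW) p &&
  sorted (fun s t : step => ~~ (vertical s && vertical t)) p.

Definition grand_motzkin_set (n : nat) (m : int) : Type :=
  {p : lpath | [&& grand_motzkin p, avoids_flat_at_odd p
                 & endpoint p == ((2 * n + 1)%N%:Z, m)]}.

Definition motzkin_set (n : nat) (m : int) : Type :=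
  {p : lpath | [&& motzkin p, avoids_flat_at_odd p
                 & endpoint p == ((2 * n + 1)%N%:Z, m)]}.

Definition vc_SDW_set (n : nat) (m : int) : Type :=
  {p : lpath | vc_SDW p && (endpoint p == (n%:Z, m))}.

Definition vc_SDW_nonneg_set (n : nat) (m : int) : Type :=
  {p : lpath | [&& vc_SDW p, nonneg_heights p & endpoint p == (n%:Z, m)]}.

(* Main.v *)
Require Import Defs.
From HB Require Import structures.
From mathcomp Require Import all_boot all_order all_algebra.
From mathcomp Require Import zify.
Set Implicit Arguments.
Unset Strict Implicit.
Unset Printing Implicit Defensive.
Import Order.TTheory GRing.Theory Num.Theory.
Local Open Scope ring_scope.

(** A step at an odd index is (1,1) or (1,-1) and is kept unchanged.  A step
    (1,d) at an even index becomes the vertical step (0,d), or is erased when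
    d = 0.  Two vertical steps are then always separated by a diagonal one, the
    heights visited are the same up to repetition, and the n odd indices
    contribute the whole horizontal displacement.  Conversely, a flat step is
    reinserted wherever a diagonal step is not preceded by a vertical one, and
    at the end if the last step is not vertical. *)

(* The flag [b] tells whether the next Motzkin step has an odd index; for
   [vc_from], whether the previous step was vertical. *)

Fixpoint to_SDW (b : bool) (p : lpath) : lpath :=
  if p is s :: p' then
    if b then s :: to_SDW false p'
    else if s == flat then to_SDW true p' else (0, s.2) :: to_SDW true p'
  else [::].

Fixpoint of_SDW (b : bool) (q : lpath) : lpath :=
  if q is s :: q' then
    if b then s :: of_SDW false q'
    else if vertical s then (1, s.2) :: of_SDW true q'
    else flat :: s :: of_SDW false q'
  else if b then [::] else [:: flat].

Fixpoint avoids_flat_from (b : bool) (p : lpath) : bool :=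
  if p is s :: p' then (b ==> (s != flat)) && avoids_flat_from (~~ b) p'
  else true.

Fixpoint vc_from (b : bool) (q : lpath) : bool :=
  if q is s :: q' then
    [&& s \in SDW, ~~ (b && vertical s) & vc_from (vertical s) q']
  else true.

(** A running height replaces the list of vertices, so that an inserted flat step merely repeats the
    test [0 <= h]. *)
Fixpoint nonneg_from (h : int) (p : lpath) : bool :=
  (0 <= h) && (if p is s :: p' then nonneg_from (h + s.2) p' else true).

Lemma avoids_flat_at_oddE p : avoids_flat_at_odd p = avoids_flat_from false p.
Proof.
suff H (b : bool) : [forall i : 'I_(size p), odd (b + i) ==> (nth 0 p i != flat)]
           = avoids_flat_from b p by exact: (H false).
elim: p b => [|s p IH] b /=; first by apply/forallP => -[].
rewrite -IH; apply/forallP/andP => [H | [H0 /forallP H] [[|i] /= Hi]].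
- split; first by move: (H ord0); rewrite addn0 oddb.
  apply/forallP => i; move: (H (lift ord0 i)); rewrite lift0 /=.
  by rewrite addnS /= !oddD !oddb addNb.
- by rewrite addn0 oddb.
- by move: (H (Ordinal (Hi : i < size p)%N)); rewrite /= addnS /= !oddD !oddb addNb.
Qed.

Lemma vc_SDWE q : vc_SDW q = vc_from false q.
Proof.
rewrite /vc_SDW; case: q => //= s q.
elim: q s => [|t q IH] s //=; first by rewrite !andbT.
by rewrite [X in _ = _ && X]andbCA -(IH t) -!andbA; do !bool_congr.
Qed.

Lemma nonneg_heightsE p : nonneg_heights p = nonneg_from 0 p.
Proof.
rewrite /nonneg_heights /vertices.
suff H (v : int * int) : all (fun w : int * int => 0 <= w.2)
    (v :: scanl (fun w s : int * int => w + s) v p) = nonneg_from v.2 p.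
  exact: (H 0).
by elim: p v => [|s p IH] v //=; rewrite -(IH (v + s)).
Qed.

Lemma endpointE p : endpoint p = \sum_(s <- p) s.
Proof.
rewrite /endpoint /vertices.
suff H (v : int * int) :
    last v (scanl (fun w s : int * int => w + s) v p) = v + \sum_(s <- p) s.
  by rewrite /= (H 0) add0r.
elim: p v => [|s p IH] v /=; first by rewrite big_nil addr0.
by rewrite big_cons addrA -IH.
Qed.

(** Every allowed step has abscissa 1. This turns the endpoint condition into the parity of the
    length required by [to_SDWK]. *)
Lemma grand_motzkin_endpoint1 p :
  grand_motzkin p -> (endpoint p).1 = (size p)%:Z.
Proof.
rewrite endpointE; elim: p => [|s p IH] /=; first by rewrite big_nil.
rewrite big_cons => /andP[]; rewrite !inE => Hs /IH /= ->.
by case/or3P: Hs => /eqP -> /=; lia.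
Qed.

Lemma vc_from_weaken q : vc_from true q -> vc_from false q.
Proof. by case: q => //= s q /and3P[-> _ ->]. Qed.

Lemma to_SDW_vc b p :
  grand_motzkin p -> avoids_flat_from b p -> vc_from b (to_SDW b p).
Proof.
elim: p b => [|s p IH] [] //=; rewrite !inE.
- move=> /andP[Hs Hp] /andP[sF Hav].
  by case/or3P: Hs sF => /eqP -> //= _; apply: IH.
- move=> /andP[Hs Hp] Hav; have := IH _ Hp Hav.
  (* The weakening serves the erased flat step: induction gives flag [true], but no vertical step
     has been emitted. *)
  by case/or3P: Hs => /eqP -> //= /vc_from_weaken.
Qed.

(** A [q] allowed after a vertical step is empty or starts diagonally, exactly the cases where
    [of_SDW false] restores an erased flat step. *)
Lemma of_SDW_diagonal q :
  vc_from true q -> of_SDW false q = flat :: of_SDW true q.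
Proof. by case: q => //= s q /and3P[_ /negbTE -> _]. Qed.

(** The parity hypothesis says that [p] stops just after an even index, as every output of [of_SDW]
    does; otherwise a spurious flat step would be appended. *)
Lemma to_SDWK b p : grand_motzkin p -> avoids_flat_from b p ->
  odd (size p) = ~~ b -> of_SDW b (to_SDW b p) = p.
Proof.
elim: p b => [|s p IH] [] //=; rewrite !inE.
- move=> /andP[_ Hp] /andP[_ Hav] Ho.
  by rewrite IH //; case: (odd _) Ho.
- move=> /andP[Hs Hp] Hav /(congr1 negb) ; rewrite negbK => Ho.
  have Hvc := to_SDW_vc Hp Hav; have := IH true Hp Hav; rewrite Ho => /(_ erefl) E.
  case/or3P: Hs => /eqP -> /=; last 2 first.
  + by rewrite E.
  + by rewrite E.
  by rewrite of_SDW_diagonal // E.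
Qed.

Lemma of_SDWK b q : vc_from b q -> to_SDW b (of_SDW b q) = q.
Proof.
elim: q b => [|s q IH] [] //=.
(* [Hq] carries the flag [vertical s], which [Hv] shows to be [false]. *)
- by case/and3P=> Hs Hv Hq; rewrite IH // -(negbTE Hv).
- rewrite !inE => /andP[].
  by case/or4P=> /eqP -> /= /IH ->.
Qed.

Lemma of_SDW_grand_motzkin b q : vc_from b q -> grand_motzkin (of_SDW b q).
Proof.
elim: q b => [|s q IH] [] //=; rewrite !inE.
- by case/and3P=> /or4P[] /eqP -> //= _ /IH ->.
- by case/andP=> /or4P[] /eqP -> //= /IH ->.
Qed.

Lemma of_SDW_avoids_flat b q : vc_from b q -> avoids_flat_from b (of_SDW b q).
Proof.
elim: q b => [|s q IH] [] //=; rewrite !inE.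
- by case/and3P=> /or4P[] /eqP -> //= _ /IH ->.
- by case/andP=> /or4P[] /eqP -> //= /IH ->.
Qed.

Lemma of_SDW_nonneg b h q :
  vc_from b q -> nonneg_from h (of_SDW b q) = nonneg_from h q.
Proof.
elim: q b h => [|s q IH] [] h //=; first by rewrite addr0 !andbT andbb.
- case/and3P=> Hs Hv Hq; rewrite (IH false) //.
  by rewrite -(negbTE Hv).
- case/andP=> _; case: ifP => _ Hq /=; first by rewrite IH.
  by rewrite addr0 IH // andbA andbb.
Qed.

(** Each diagonal step closes a pair of Motzkin steps, at an even and an odd index. One even-index
    step remains after the last pair; when [b] holds, the first even-index step lies before [q] and
    is not counted. *)
Lemma of_SDW_endpoint b q : vc_from b q ->
  endpoint (of_SDW b q)
  = (2%:Z * (endpoint q).1 + (~~ b)%:Z, (endpoint q).2).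
Proof.
rewrite !endpointE; elim: q b => [|s q IH] [] /=.
- by rewrite !big_nil.
- by rewrite big_seq1 big_nil.
- case/and3P=> Hs Hv Hq; rewrite !big_cons IH -?(negbTE Hv) //.
  move: Hs Hv; rewrite !inE.
  by case/or4P=> /eqP -> //= _; congr (_, _) => /=; lia.
- rewrite !inE => /andP[].
  by case/or4P=> /eqP -> /= Hq; rewrite !big_cons IH //;
    congr (_, _) => /=; lia.
Qed.

Lemma of_SDW_endpoint_eq n m q : vc_from false q ->
  (endpoint (of_SDW false q) == ((2 * n + 1)%N%:Z, m))
  = (endpoint q == (n%:Z, m)).
Proof.
move=> /of_SDW_endpoint ->; rewrite [RHS]/eq_op /= xpair_eqE; congr (_ && _).
by apply/eqP/eqP; lia.
Qed.

Lemma to_SDW_endpointK n m p :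
  grand_motzkin p -> avoids_flat_from false p ->
  endpoint p == ((2 * n + 1)%N%:Z, m) -> of_SDW false (to_SDW false p) = p.
Proof.
move=> Hp Hav /eqP E; apply: to_SDWK => //.
have := grand_motzkin_endpoint1 Hp; rewrite E /= => -[<-].
by rewrite addn1 mul2n /= odd_double.
Qed.

Lemma sig_bijective (T : Type) (P Q : pred T) (f g : T -> T) :
  (forall x, P x -> Q (f x) /\ g (f x) = x) ->
  (forall y, Q y -> P (g y) /\ f (g y) = y) ->
  exists F : {x | P x} -> {y | Q y}, bijective F.
Proof.
move=> Hf Hg.
exists (fun x => exist _ (f (val x)) (Hf _ (valP x)).1).
exists (fun y => exist _ (g (val y)) (Hg _ (valP y)).1) => -[x Hx];
  apply: val_inj => /=.
- exact: (Hf x Hx).2.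
- exact: (Hg x Hx).2.
Qed.

Theorem theorem13 (n : nat) (m : int) :
  (exists f : motzkin_set n m -> vc_SDW_nonneg_set n m, bijective f) /\
  (exists f : grand_motzkin_set n m -> vc_SDW_set n m, bijective f).
Proof.
split; apply: (@sig_bijective _ _ _ (to_SDW false) (of_SDW false)) => p.
- rewrite avoids_flat_at_oddE vc_SDWE /motzkin !nonneg_heightsE.
  case/and3P=> /andP[Hp Hnn] Hav He.
  (* Heights and endpoints are compared only along [of_SDW]; [K] carries these facts over to
     [to_SDW]. *)
  have K := to_SDW_endpointK Hp Hav He; have Hvc := to_SDW_vc Hp Hav.
  by rewrite -(of_SDW_endpoint_eq n m Hvc) -(of_SDW_nonneg 0 Hvc) K Hvc Hnn.
- rewrite avoids_flat_at_oddE vc_SDWE /motzkin !nonneg_heightsE.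
  case/and3P=> Hvc Hnn He.
  by rewrite of_SDW_grand_motzkin ?of_SDW_avoids_flat ?of_SDW_nonneg
    ?of_SDW_endpoint_eq ?of_SDWK ?Hnn.
- rewrite avoids_flat_at_oddE vc_SDWE => /and3P[Hp Hav He].
  have K := to_SDW_endpointK Hp Hav He; have Hvc := to_SDW_vc Hp Hav.
  by rewrite -(of_SDW_endpoint_eq n m Hvc) K Hvc.
- rewrite avoids_flat_at_oddE vc_SDWE => /andP[Hvc He].
  by rewrite of_SDW_grand_motzkin ?of_SDW_avoids_flat ?of_SDW_endpoint_eq
    ?of_SDWK.
Qed.
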